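(* Let $n\ge 2$, $k\in\{1,\dots,n-1\}$, $r\in\mathbb{R}$, $\boldsymbol a\in\mathbb{R}^n$, and let $F$, $F_r$, $G_r$, the KKT conditions with solution $(u^\star,l^\star)$, and the projection $\boldsymbol x^\star$ be as defined in the context. Suppose $u_r^\star$ is a solution (in the domain $u>\vec a_{k+1}$ of $G_r$) of $F_r(u)=G_r(u)$, if it exists. Let $l_r^\star:=F_r(u_r^\star)$ and $m_r:=|\mathcal I(\boldsymbol a,u_r^\star,+)|$. Then $m_r\le k$, and the solution $(u^\star,l^\star)$ to the KKT conditions can be recovered as follows. (Case 1, inactive) If $u_r^\star$ does not exist, then $r\ge\mathrm{T}_{(k)}(\boldsymbol a)$, and the optimal solution is $\boldsymbol x^\star=\boldsymbol a$. In this case, $u^\star=l^\star$. (Case 2, interior) If $F_r(u_r^\star)<u_r^\star$ and $m_r<k$, then $u_r^\star>\vec a_k$. In this case, $u^\star=u_r^\star$ and $l^\star=F(u^\star)=F_r(u^\star)$. Moreover, $u^\star-l^\star>\vec a_k-\vec a_{k+1}$. (Case 3, boundary) If $F_r(u_r^\star)<u_r^\star$ and $m_r=k$, then $\vec a_{k+1}<\vec a_k$ and $u_r^\star\in(\vec a_{k+1},\vec a_k]$. In this case, $u^\star=\vec a_k=\min\{a_i:a_i\ge u_r^\star\}$ and $l^\star=F(u^\star)$. Moreover, $0<u^\star-l^\star\le\vec a_k-\vec a_{k+1}$.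
   Context: Notation: $\vec a_1\ge\cdots\ge\vec a_n$ are the components of $\boldsymbol a$ in nonincreasing order; $\mathrm{T}_{(k)}(\boldsymbol a):=\sum_{i=1}^k\vec a_i$; $\mathcal I(\boldsymbol a,u,+):=\{i: a_i\ge u\}$. Projection problem: $\boldsymbol x^\star$ is the unique minimizer of $\frac12\|\boldsymbol x-\boldsymbol a\|^2$ over $\{\boldsymbol x\in\mathbb{R}^n:\mathrm{T}_{(k)}(\boldsymbol x)\le r\}$. KKT conditions: a pair $(u^\star,l^\star)$ with $u^\star\ge\vec a_k\ge l^\star$ satisfies the KKT conditions if $$\sum_{i=1}^k\max\{u^\star-\vec a_i,0\}=\sum_{j=k+1}^n\max\{\vec a_j-l^\star,0\},\qquad \sum_{i=1}^n\max\{a_i-u^\star,0\}+l^\star k=\min\{\mathrm{T}_{(k)}(\boldsymbol a),r\}.$$ (The projection is then $x^\star_i=a_i-(u^\star-l^\star)$ if $a_i>u^\star$, $x^\star_i=l^\star$ if $l^\star\le a_i\le u^\star$, and $x_i^\star=a_i$ if $a_i<l^\star$.) Functions: $$F(u)=\frac1k\Big(\min\{\mathrm{T}_{(k)}(\boldsymbol a),r\}-\sum_{i=1}^n\max\{a_i-u,0\}\Big),\qquad F_r(u)=\frac1k\Big(r-\sum_{i=1}^n\max\{a_i-u,0\}\Big),$$ $$g_r(u,l):=\sum_{i=1}^n\max\{a_i-u,0\}-\sum_{i=1}^n\max\{a_i-l,0\}+k(u-l),$$ and, for $u>\vec a_{k+1}$, $G_r(u):=\min\{l: g_r(u,l)=0\}$.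 *)

(* Defs.v *)
From HB Require Import structures.
From mathcomp Require Import all_boot all_order all_algebra.
From mathcomp Require Import boolp classical_sets reals.
Set Implicit Arguments.
Unset Strict Implicit.
Unset Printing Implicit Defensive.
Import Order.TTheory GRing.Theory Num.Theory.
Local Open Scope ring_scope.

Section Defs.
Variables (R : realType) (n : nat).
Implicit Types (a x : 'rV[R]_n) (r u l : R) (k : nat).

Definition is_minimum (A : set R) (m : R) : Prop := A m /\ lbound A m.

(* [desc a i] is the [i]-th largest component of [a], counted from 1 with
   multiplicity; it is meaningful for 1 <= i <= n only. *)
Definition desc a (i : nat) : R :=
  nth 0 (sort (fun x y : R => y <= x) [seq a ord0 j | j <- enum 'I_n]) i.-1.

Definition topsum k a : R := \sum_(1 <= i < k.+1) desc a i.

Definition Iplus a u : {set 'I_n} := [set i : 'I_n | u <= a ord0 i]%SET.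

Definition excess a u : R := \sum_(i < n) Num.max (a ord0 i - u) 0.

(* The squared Euclidean norm is written out because the norm that the library
   puts on matrices is the sup norm. *)
Definition objective a x : R :=
  2^-1 * \sum_(i < n) (x ord0 i - a ord0 i) ^+ 2.

Definition is_projection a r k x : Prop :=
  topsum k x <= r /\
  forall y : 'rV[R]_n, topsum k y <= r -> objective a x <= objective a y.

Definition KKT a r k u l : Prop :=
  [/\ desc a k <= u, l <= desc a k,
      \sum_(1 <= i < k.+1) Num.max (u - desc a i) 0 =
        \sum_(k.+1 <= j < n.+1) Num.max (desc a j - l) 0
    & excess a u + l * k%:R = Num.min (topsum k a) r].

Definition F a r k u : R := k%:R^-1 * (Num.min (topsum k a) r - excess a u).

Definition F_r a r k u : R := k%:R^-1 * (r - excess a u).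

Definition g_r a k u l : R := excess a u - excess a l + k%:R * (u - l).

(* The minimum exists whenever [1 <= k < n] and [desc a k.+1 < u], the domain
   on which [G_r] is used; the default value 0 is never reached there. *)
Definition G_r a k u : R :=
  xget 0 (is_minimum (fun l => g_r a k u l = 0)).

Definition solves_FG a r k u : Prop :=
  desc a k.+1 < u /\ F_r a r k u = G_r a k u.

End Defs.

(* Main.v *)
Require Import Defs.
From HB Require Import structures.
From mathcomp Require Import all_boot all_order all_algebra.
From mathcomp Require Import boolp classical_sets reals.
From mathcomp Require Import topology normedtype realfun.
From mathcomp Require Import lra zify.
Set Implicit Arguments.
Unset Strict Implicit.
Unset Printing Implicit Defensive.
Import Order.TTheory GRing.Theory Num.Theory.
Import numFieldNormedType.Exports.
Local Open Scope ring_scope.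

(** Write b_1 >= ... >= b_n for the sorted entries of a, T for the sum of the
    first k of them, and e(x) for the total excess of the entries over x.
    Everything is governed by the single convex function

      Phi(x) = e(x) + k x,

    whose slope at x is k minus the number of entries above x.  Hence Phi
    equals its minimum T on [b_(k+1), b_k] ([tilted_flat]), falls with slope at
    most -1 to the left of b_(k+1) ([tilted_decreasing]) and rises with slope
    at least 1 to the right of b_k ([tilted_increasing]).

    For u >= b_k the part of Phi(u) above T is the left side of the first KKT
    equation, and for l <= b_k the part of Phi(l) above T is its right side.  So
    (u, l) is a KKT pair iff l <= b_k <= u, Phi(u) = Phi(l) and
    e(u) + k l = min(T, r) ([KKT_tiltedP]).  Likewise g_r(u, l) = Phi(u) - Phi(l),
    so G_r(u) is the only point of Phi^-1(Phi(u)) that is at most b_(k+1), and u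
    solves F_r(u) = G_r(u) iff l = F_r(u) satisfies l <= b_(k+1),
    Phi(u) = Phi(l) and e(u) + k l = r ([solves_FG_tiltedP]).  The two systems
    differ only in the range allowed for u and l and in the cap of r by T.

    A KKT pair exists by the intermediate value theorem ([KKT_exists]) and is
    unique because raising u strictly raises Phi(u), while the second equation
    then forces l to rise, which cannot raise Phi(l) ([KKT_unique]).  By
    uniqueness, each case only needs a KKT pair to be exhibited:
    - If r < T, a solution u_r can be read off the KKT pair: either the pair
      itself works, or both of its coordinates lie in the flat interval, and
      then lowering them by the same amount until l = b_(k+1) preserves
      e(u) + k l, since e has slope -k there ([solves_FG_exists]).  So if there
      is no solution then T <= r, and (b_k, b_k) is the KKT pair.
    - If fewer than k entries are at least u_r, then u_r > b_k, and
      (u_r, F_r(u_r)) is itself a KKT pair.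
    - If k entries are at least u_r, then b_(k+1) < u_r <= b_k, so Phi(u_r) = T
      and F_r(u_r) = b_(k+1).  Raising both coordinates by b_k - u_r stays in
      the flat interval and gives the KKT pair
      (b_k, b_(k+1) + b_k - u_r). *)

(** * Sorted entries *)

Section Sorting.
Variables (R : realType) (n : nat) (a : 'rV[R]_n).
Local Notation sorted_entries :=
  (sort (fun x y : R => y <= x) [seq a ord0 j | j <- enum 'I_n]).

Lemma size_sorted_entries : size sorted_entries = n.
Proof. by rewrite size_sort size_map size_enum_ord. Qed.

Lemma desc_noninc i j : (1 <= i)%N -> (i <= j)%N -> (j <= n)%N ->
  desc a j <= desc a i.
Proof.
move=> i1 ij jn.
have tot : total (fun x y : R => y <= x) by move=> x y; exact: le_total.
have ge_trans : transitive (fun x y : R => y <= x).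
  by move=> y x z xy yz; exact: le_trans yz xy.
apply: (sorted_leq_nth ge_trans (fun x : R => lexx x) 0 (sort_sorted tot _));
  rewrite ?inE ?size_sorted_entries; lia.
Qed.

(** Sorting permutes the entries, so every symmetric aggregate of a can be read
    off its sorted entries; the operator is kept general to serve both real sums
    and cardinalities. *)
Lemma big_desc (V : Type) (idx : V) (op : Monoid.com_law idx) (f : R -> V) :
  \big[op/idx]_(i < n) f (a ord0 i) = \big[op/idx]_(1 <= i < n.+1) f (desc a i).
Proof.
transitivity (\big[op/idx]_(x <- sorted_entries) f x).
  by rewrite (perm_big _ (permEl (perm_sort _ _))) big_map big_enum.
by rewrite (big_nth 0) size_sorted_entries big_add1.
Qed.

Lemma entry_is_desc i : exists2 j, (1 <= j <= n)%N & a ord0 i = desc a j.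
Proof.
have : a ord0 i \in sorted_entries by rewrite mem_sort map_f ?mem_enum.
move=> /(nthP 0) [j]; rewrite size_sorted_entries => jn <-.
by exists j.+1.
Qed.

Lemma desc_is_entry j : (1 <= j <= n)%N -> exists i, desc a j = a ord0 i.
Proof.
move=> jn; have : desc a j \in sorted_entries.
  by rewrite mem_nth // size_sorted_entries; lia.
by rewrite mem_sort => /mapP [i _ ->]; exists i.
Qed.

Lemma card_Iplus_ge u k : (k <= n)%N -> (0 < k)%N -> u <= desc a k ->
  (k <= #|Iplus a u|)%N.
Proof.
move=> kn k0 uk; rewrite -sum1_card big_mkcond /=.
under eq_bigr do rewrite inE.
rewrite (big_desc _ (fun x => if (u <= x)%R then 1 else 0)%N).
rewrite (big_cat_nat (n := k.+1)) //= -[X in (X <= _)%N]addn0 leq_add //.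
rewrite big_nat (eq_bigr (fun=> 1%N)) -?big_nat ?sum_nat_const_nat; first by lia.
by move=> i ik; rewrite ifT // (le_trans uk) // desc_noninc; lia.
Qed.

Lemma card_Iplus_le u k : (k < n)%N -> desc a k.+1 < u -> (#|Iplus a u| <= k)%N.
Proof.
move=> kn uk; rewrite -sum1_card big_mkcond /=.
under eq_bigr do rewrite inE.
rewrite (big_desc _ (fun x => if (u <= x)%R then 1 else 0)%N).
rewrite (big_cat_nat (n := k.+1)) //=; last exact: ltnW.
rewrite [X in (_ + X)%N]big_nat [X in (_ + X)%N]big1 ?addn0.
  apply: (@leq_trans (\sum_(1 <= i < k.+1) 1)%N).
    by apply: leq_sum => i _; case: ifP.
  by rewrite sum_nat_const_nat; lia.
move=> i ik; rewrite ifF //; apply/negbTE; rewrite -ltNge.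
by apply: le_lt_trans uk; apply: desc_noninc; lia.
Qed.

End Sorting.

(** * The tilted excess *)

(** The convex function Phi whose level sets encode both the first KKT equation
    and G_r. *)
Definition tilted (R : realType) (n : nat) (a : 'rV[R]_n) (k : nat) (x : R) : R :=
  excess a x + k%:R * x.

Lemma ler_pos_part (R : realDomainType) (x y : R) :
  x <= y -> Num.max x 0 <= Num.max y 0.
Proof. by move=> xy; rewrite ge_max !le_max xy lexx orbT. Qed.

Lemma excess_noninc (R : realType) (n : nat) (a : 'rV[R]_n) x y :
  x <= y -> excess a y <= excess a x.
Proof.
move=> xy; apply: ler_sum => i _; apply: ler_pos_part; lra.
Qed.

Lemma continuous_excess (R : realType) (n : nat) (a : 'rV[R]_n) :
  continuous (excess a).
Proof.
move=> x; apply: cvg_big => [|i _].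
  exact: add_continuous.
apply: (@continuous_max _ _ (fun y => a ord0 i - y) (fun=> 0) x); last exact: cvg_cst.
by apply: cvgB; [exact: cvg_cst|exact: cvg_id].
Qed.

Section Shape.
Variables (R : realType) (n k : nat) (a : 'rV[R]_n).
Hypotheses (k0 : (0 < k)%N) (kn : (k < n)%N).
Local Notation Phi := (tilted a k).
Local Notation T := (topsum k a).

Lemma excess_split x : excess a x =
  \sum_(1 <= i < k.+1) Num.max (desc a i - x) 0 +
  \sum_(k.+1 <= j < n.+1) Num.max (desc a j - x) 0.
Proof.
rewrite /excess (big_desc a _ (fun y => Num.max (y - x) 0)) /=.
by rewrite (big_cat_nat (n := k.+1)) //; lia.
Qed.

Lemma sum_const_top (x : R) : \sum_(1 <= i < k.+1) x = k%:R * x.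
Proof. by rewrite sumr_const_nat subSS subn0 mulr_natl. Qed.

(** Entries past the k-th contribute no excess over x, and
    max(b - x, 0) + x = b + max(x - b, 0) for each of the first k. *)
Lemma tilted_right x : desc a k.+1 <= x ->
  Phi x = T + \sum_(1 <= i < k.+1) Num.max (x - desc a i) 0.
Proof.
move=> kx; rewrite /tilted /topsum excess_split.
have -> : \sum_(k.+1 <= j < n.+1) Num.max (desc a j - x) 0 = 0.
  rewrite big_nat big1 // => j jk; apply/max_idPr.
  by rewrite subr_le0 (le_trans _ kx) // desc_noninc; lia.
rewrite addr0 -sum_const_top -!big_split /=; apply: eq_bigr => i _.
by case: (leP (_ - x) 0); case: (leP (x - _) 0); lra.
Qed.

(** Each of the first k entries b is at least x, so that its excess plus x is
    b itself. *)
Lemma tilted_left x : x <= desc a k ->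
  Phi x = T + \sum_(k.+1 <= j < n.+1) Num.max (desc a j - x) 0.
Proof.
move=> xk; rewrite /tilted /topsum excess_split addrAC; congr (_ + _).
rewrite -sum_const_top -!big_split /= !big_nat; apply: eq_bigr => i ik.
have : desc a k <= desc a i by apply: desc_noninc; lia.
by case: (leP (_ - x) 0); lra.
Qed.

Lemma desc_gap : desc a k.+1 <= desc a k.
Proof. by apply: desc_noninc; lia. Qed.

Lemma tilted_flat x : desc a k.+1 <= x <= desc a k -> Phi x = T.
Proof.
move=> /andP[kx xk]; rewrite tilted_right // big_nat big1 ?addr0 // => i ik.
by apply/max_idPr; rewrite subr_le0 (le_trans xk) // desc_noninc; lia.
Qed.

(** The k-th term of the sum in [tilted_right] alone grows at rate 1, and the
    others do not decrease. *)
Lemma tilted_increasing x y : desc a k <= x -> x <= y -> Phi x + (y - x) <= Phi y.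
Proof.
move=> kx xy; have gap := desc_gap.
rewrite !tilted_right; [|lra|lra].
rewrite -!addrA lerD2l !big_nat_recr //=.
have : \sum_(1 <= i < k) Num.max (x - desc a i) 0 <=
       \sum_(1 <= i < k) Num.max (y - desc a i) 0.
  by apply: ler_sum => i _; apply: ler_pos_part; lra.
by case: (leP (x - _)); case: (leP (y - _)); lra.
Qed.

(** Symmetrically, the (k+1)-st term of the sum in [tilted_left] grows at rate 1
    as its argument decreases. *)
Lemma tilted_decreasing x y : x <= y -> y <= desc a k.+1 ->
  Phi y + (y - x) <= Phi x.
Proof.
move=> xy yk; have gap := desc_gap.
rewrite !tilted_left; [|lra|lra].
rewrite -!addrA lerD2l [X in X + _ <= _]big_ltn ?ltnS // [leRHS]big_ltn ?ltnS //.
have : \sum_(k.+2 <= j < n.+1) Num.max (desc a j - y) 0 <=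
       \sum_(k.+2 <= j < n.+1) Num.max (desc a j - x) 0.
  by apply: ler_sum => i _; apply: ler_pos_part; lra.
by case: (leP (_ - x)); case: (leP (_ - y)); lra.
Qed.

Lemma tilted_noninc x y : x <= y -> y <= desc a k -> Phi y <= Phi x.
Proof.
move=> xy yk; rewrite !tilted_left ?(le_trans xy) // lerD2l.
by apply: ler_sum => i _; apply: ler_pos_part; lra.
Qed.

Lemma tilted_ge x : T <= Phi x.
Proof.
have [kx|xk] := leP (desc a k.+1) x.
  by rewrite tilted_right // lerDl sumr_ge0 // => i _; rewrite le_max lexx orbT.
rewrite tilted_left ?(le_trans (ltW xk)) ?desc_gap //.
by rewrite lerDl sumr_ge0 // => i _; rewrite le_max lexx orbT.
Qed.

Lemma continuous_tilted : continuous Phi.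
Proof.
move=> x; apply: cvgD; first exact: continuous_excess.
by apply: cvgM; [exact: cvg_cst|exact: cvg_id].
Qed.


(** * The two systems of equations in terms of Phi *)

(** This makes the set defining G_r meet the half-line where Phi is injective,
    whence the minimum exists. *)
Lemma tilted_left_preimage u :
  exists2 l, l <= desc a k.+1 & Phi l = Phi u.
Proof.
set b := desc a k.+1; have PbT : Phi b = T by rewrite tilted_flat // lexx desc_gap.
have Tu := tilted_ge u.
(* Slope -1 at most: going left by the missing height suffices. *)
pose c := b - (Phi u - T).
have cb : c <= b by rewrite /c; lra.
have Pc := tilted_decreasing cb (lexx _).
have [||l] := @IVT R Phi c b (Phi u) cb.
- by apply: continuous_subspaceT; exact: continuous_tilted.
- by rewrite ge_min le_max; apply/andP; split; apply/orP; [right|left];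
    rewrite /c in Pc *; lra.
by rewrite in_itv /= => /andP[_ lb] Pl; exists l.
Qed.

(** Strict decrease of Phi on the left half-line makes any preimage found there
    the least one. *)
Lemma G_r_eq u l : l <= desc a k.+1 -> Phi l = Phi u -> G_r a k u = l.
Proof.
move=> lb Pl.
have g0 x : g_r a k u x = 0 <-> Phi x = Phi u.
  by rewrite /g_r /tilted; split; lra.
apply: xget_unique.
  split=> [|x /g0 Px]; first exact/g0.
  rewrite leNgt; apply/negP => xl.
  by have := tilted_decreasing (ltW xl) lb; lra.
move=> x [/g0 Px minx].
have xl : x <= l by apply: minx; apply/g0.
by have := tilted_decreasing xl lb; lra.
Qed.

Let kR : 0 < k%:R :> R. Proof. by rewrite ltr0n. Qed.

Lemma divk_eq (m e l : R) : e + l * k%:R = m <-> l = k%:R^-1 * (m - e).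
Proof.
have kne : k%:R != 0 :> R by rewrite gt_eqF.
split=> [<-|->]; first by rewrite addrAC subrr add0r mulrC mulfK.
by rewrite mulrC mulrA divff // mul1r addrC subrK.
Qed.

(** By [G_r_eq], equality with G_r u only asks that l lie in the left half-line
    and on the level set of u, which removes the choice hidden in G_r. *)
Lemma solves_FG_tiltedP r u : solves_FG a r k u <->
  exists2 l, F_r a r k u = l &
    [/\ desc a k.+1 < u, l <= desc a k.+1, Phi l = Phi u &
        excess a u + l * k%:R = r].
Proof.
split=> [[bu FG]|[l Fl [bu lb Pl _]]]; last by split=> //; rewrite Fl (G_r_eq lb).
have [l lb Pl] := tilted_left_preimage u.
have Fl : F_r a r k u = l by rewrite FG (G_r_eq lb).
by exists l => //; split=> //; apply/divk_eq.
Qed.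

(** The sums of the first KKT equation are Phi u - T and Phi l - T, by
    [tilted_right] and [tilted_left]. *)
Lemma KKT_tiltedP r u l : KKT a r k u l <->
  [/\ desc a k <= u, l <= desc a k, Phi u = Phi l &
      excess a u + l * k%:R = Num.min T r].
Proof.
have gap := desc_gap.
split=> -[ku lk E S]; split=> //.
  by rewrite tilted_right ?(le_trans gap) // tilted_left // E.
by move: E; rewrite tilted_right ?(le_trans gap) // tilted_left // => /addrI.
Qed.

(** * Existence and uniqueness of solutions *)

(** If u1 < u2 then Phi u1 < Phi u2 while the excess does not increase, so the
    second equation gives l1 <= l2 and therefore Phi l2 <= Phi l1: this
    contradicts Phi u1 = Phi l1 and Phi u2 = Phi l2. *)
Lemma KKT_unique r u1 l1 u2 l2 :
  KKT a r k u1 l1 -> KKT a r k u2 l2 -> u1 = u2 /\ l1 = l2.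
Proof.
wlog le_u : u1 l1 u2 l2 / u1 <= u2.
  move=> W K1 K2; have [u12|u21] := leP u1 u2; first exact: W.
  by have [-> ->] := W _ _ _ _ (ltW u21) K2 K1.
move=> /KKT_tiltedP [ku1 lk1 E1 S1] /KKT_tiltedP [ku2 lk2 E2 S2].
have l12 : l1 <= l2.
  by rewrite -(ler_pM2r kR); have := excess_noninc a le_u; lra.
have u12 : u1 = u2.
  apply/eqP; rewrite eq_le le_u /=.
  have := tilted_increasing ku1 le_u; have := tilted_noninc l12 lk2; lra.
split=> //; apply/(mulIf (lt0r_neq0 kR)); rewrite u12 in S1; lra.
Qed.

(** The second equation says l = F u; substituting it into Phi u = Phi l leaves
    one equation in u, solved by the intermediate value theorem. *)
Lemma KKT_exists r : exists p : R * R, KKT a r k p.1 p.2.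
Proof.
set bk := desc a k; have gap := desc_gap.
have PbT : Phi bk = T by rewrite tilted_flat // lexx gap.
have mT : Num.min T r <= T by rewrite ge_min lexx.
have Fb : F a r k bk <= bk.
  rewrite -(ler_pM2r kR).
  have /divk_eq : F a r k bk = F a r k bk by [].
  by move: PbT; rewrite /tilted; lra.
(* Capping l at bk keeps it where Phi is nonincreasing; at a zero of h the cap
   turns out not to be active. *)
pose h u := Phi u - Phi (Num.min (F a r k u) bk).
(* Slope at least 1: from M on, Phi is at least its value at F bk. *)
pose M := bk + (Phi (F a r k bk) - T).
have FT := tilted_ge (F a r k bk).
have bM : bk <= M by rewrite /M; lra.
have hb : h bk <= 0 by rewrite /h min_l //; lra.
have hM : 0 <= h M.
  have PM := tilted_increasing (lexx _) bM.
  have FM : F a r k bk <= F a r k M.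
    rewrite ler_pM2l ?invr_gt0 // lerD2l lerN2; exact: excess_noninc.
  have : Phi (Num.min (F a r k M) bk) <= Phi (F a r k bk).
    by apply: tilted_noninc; rewrite ?ge_min ?le_min ?lexx ?orbT ?FM.
  have MbE : M - bk = Phi (F a r k bk) - T by rewrite /M; lra.
  by rewrite /h; move: PM; rewrite MbE PbT; lra.
have h_cont : continuous h.
  move=> x; apply: cvgB; first exact: continuous_tilted.
  apply: (@continuous_comp _ _ _ (fun u => Num.min (F a r k u) bk));
    last exact: continuous_tilted.
  apply: (@continuous_min _ _ (fun u => F a r k u) (fun=> bk)); last exact: cvg_cst.
  apply: cvgM; first exact: cvg_cst.
  by apply: cvgB; [exact: cvg_cst|exact: continuous_excess].
have [||u] := @IVT R h bk M 0 bM.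
- exact: continuous_subspaceT.
- by rewrite ge_min le_max hb hM orbT.
rewrite in_itv /= => /andP[bu _] hu.
(* An active cap would give Phi u = T, hence u = bk, where F does not exceed bk. *)
have [Fu|Fu] := leP (F a r k u) bk.
  exists (u, F a r k u); apply/KKT_tiltedP; split=> //=; last exact/divk_eq.
  by move: hu; rewrite /h min_l //; lra.
have ub : u = bk.
  move: hu; rewrite /h min_r ?ltW // => hu.
  by have := tilted_increasing (lexx _) bu; rewrite -/bk; lra.
by rewrite ub in Fu; lra.
Qed.

(** The KKT pair (u, l) is moved along the flat part of Phi, if it lies there,
    until l reaches the range of G_r. *)
Lemma solves_FG_exists r : r < T -> exists u, solves_FG a r k u.
Proof.
move=> rT; have gap := desc_gap.
have [[u l] /= /KKT_tiltedP [bu lb E S]] := KKT_exists r.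
rewrite min_r ?ltW // in S.
have [bl|lb1] := leP (desc a k.+1) l.
  have PlT : Phi l = T by rewrite tilted_flat // bl lb.
  have ub : u = desc a k.
    by have := tilted_increasing (lexx _) bu; rewrite tilted_flat ?lexx ?gap //; lra.
  subst u.
  (* Excess has slope -k on the flat part, so an equal shift of u and l keeps
     excess u + k l. *)
  pose v := desc a k - (l - desc a k.+1).
  have lltb : l < desc a k.
    by rewrite -(ltr_pM2r kR); move: S PlT E; rewrite /tilted; lra.
  have bv : desc a k.+1 < v by rewrite /v; lra.
  have Pv : Phi v = T by rewrite tilted_flat // ltW //= /v; lra.
  have Sv : excess a v + desc a k.+1 * k%:R = r.
    move: S Pv E PlT; rewrite /tilted /v; lra.
  exists v; apply/solves_FG_tiltedP; exists (desc a k.+1); first by symmetry; apply/divk_eq.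
  by split=> //; rewrite tilted_flat // lexx.
exists u; apply/solves_FG_tiltedP; exists l; first by symmetry; apply/divk_eq.
split=> //; last exact: ltW.
rewrite ltNge; apply/negP => ub1.
have u_eq : u = desc a k.+1 by lra.
have := tilted_decreasing (ltW lb1) (lexx _); rewrite -E u_eq; lra.
Qed.

(** * The projection of a feasible point *)

Lemma projection_inactive r : T <= r -> unique (is_projection a r k) a.
Proof.
have obj0 : objective a a = 0.
  by rewrite /objective big1 ?mulr0 // => i _; rewrite subrr expr0n.
have obj_ge0 y : 0 <= objective a y.
  by rewrite mulr_ge0 ?invr_ge0 // sumr_ge0 // => i _; exact: sqr_ge0.
move=> Tr; split=> [|x [_ minx]]; first by split=> // y _; rewrite obj0.
have : objective a x = 0 by apply/le_anti; rewrite obj_ge0 -obj0 minx.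
move=> /eqP; rewrite mulf_eq0 invr_eq0 pnatr_eq0 /= psumr_eq0; last first.
  by move=> i _; exact: sqr_ge0.
move=> /allP x0; apply/rowP => i; apply/esym/eqP.
by have := x0 i (mem_index_enum _); rewrite sqrf_eq0 subr_eq0.
Qed.

End Shape.

(** * Recovering the KKT pair *)

Theorem lemma4 (R : realType) (n k : nat) (r : R) (a : 'rV[R]_n)
    (hn : (2 <= n)%N) (hk : (1 <= k <= n.-1)%N) :
  (exists! p : R * R, KKT a r k p.1 p.2) /\
  forall ustar lstar : R, KKT a r k ustar lstar ->
    ((~ exists ur : R, solves_FG a r k ur) ->
       [/\ topsum k a <= r,
           unique (is_projection a r k) a
         & ustar = lstar]) /\
    (forall ur : R, solves_FG a r k ur ->
       let lr := F_r a r k ur in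
       let mr := #|Iplus a ur| in
       [/\ (mr <= k)%N,
           (lr < ur -> (mr < k)%N ->
             [/\ desc a k < ur,
                 ustar = ur,
                 lstar = F a r k ustar /\ F a r k ustar = F_r a r k ustar
               & desc a k - desc a k.+1 < ustar - lstar])
         & (lr < ur -> mr = k ->
             [/\ desc a k.+1 < desc a k,
                 desc a k.+1 < ur <= desc a k,
                 ustar = desc a k /\
                 is_minimum
                   (fun x : R => exists i : 'I_n, ur <= a ord0 i /\ x = a ord0 i)
                   (desc a k),
                 lstar = F a r k ustar
               & 0 < ustar - lstar <= desc a k - desc a k.+1])]).
Proof.
have k0 : (0 < k)%N by lia.
have kn : (k < n)%N by lia.
have kR : 0 < k%:R :> R by rewrite ltr0n.
have gap := desc_gap a k0 kn; set b := desc a k in gap *.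
have flat := tilted_flat k0 kn.
have PbT : tilted a k b = topsum k a by rewrite flat // lexx gap.
split.
  have [[u l] /= K] := KKT_exists a k0 kn r.
  exists (u, l); split=> // -[u' l'] /= K'.
  by have [-> ->] := KKT_unique k0 kn K K'.
move=> us ls Ks; split.
  move=> nosol.
  have Tr : topsum k a <= r.
    by rewrite leNgt; apply/negP => /(solves_FG_exists k0 kn).
  split=> //; first exact: projection_inactive.
  (* As T <= r, the pair (b, b) satisfies the second equation: e(b) + k b = T. *)
  have Kb : KKT a r k b b.
    apply/KKT_tiltedP => //; split=> //; rewrite min_l //.
    by move: PbT; rewrite /tilted; lra.
  by have [-> ->] := KKT_unique k0 kn Ks Kb.
move=> ur /(solves_FG_tiltedP _ k0 kn) [l Fl [bu lb Pl Sl]] /=; rewrite Fl.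
split=> [|_ mk|_ mk].
- exact: card_Iplus_le.
- have ur_gt : b < ur.
    rewrite ltNge; apply/negP => urb; move: mk; rewrite ltnNge.
    by rewrite card_Iplus_ge // ltnW.
  (* T = e(b) + k b, and both terms dominate their counterparts in
     r = e(ur) + k l. *)
  have rT : r <= topsum k a.
    have : l * k%:R <= b * k%:R by rewrite ler_pM2r // (le_trans lb).
    by have := excess_noninc a (ltW ur_gt); move: PbT; rewrite /tilted; lra.
  have K : KKT a r k ur l.
    by apply/KKT_tiltedP => //; rewrite min_r //; split=> //; [exact: ltW|exact: le_trans gap].
  have [-> ->] := KKT_unique k0 kn Ks K.
  have FF : F a r k ur = F_r a r k ur by rewrite /F min_r.
  by split=> //; [rewrite FF|lra].
have urb : ur <= b.
  rewrite leNgt; apply/negP => ur_gt.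
  have : (#|Iplus a ur| <= k.-1)%N by apply: card_Iplus_le; rewrite ?prednK //; lia.
  by rewrite mk; lia.
have PuT : tilted a k ur = topsum k a by rewrite flat // ltW.
have lE : l = desc a k.+1.
  have := tilted_decreasing k0 kn lb (lexx _).
  by rewrite Pl PuT flat ?lexx ?gap //; lra.
(* F b solves e(b) + k F b = r = e(ur) + k b_(k+1), with e of slope -k between
   ur and b. *)
have FbE : F a r k b = b - ur + desc a k.+1.
  apply/esym/divk_eq => //; rewrite min_r.
    by move: PbT PuT Sl; rewrite /tilted lE; lra.
  have : desc a k.+1 * k%:R <= ur * k%:R by rewrite ler_pM2r // ltW.
  by move: PuT Sl; rewrite /tilted lE; lra.
have K : KKT a r k b (F a r k b).
  apply/KKT_tiltedP => //; split=> //; last by apply/divk_eq.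
    by rewrite FbE -/b; lra.
  by rewrite PbT flat // FbE; apply/andP; split; rewrite -?/b; lra.
have [-> ->] := KKT_unique k0 kn Ks K.
split=> //; first lra.
- by apply/andP.
- split=> //; split.
    have [|i bi] := @desc_is_entry _ _ a k; first lia.
    by exists i; rewrite -bi.
  move=> x [i [uri ->]]; have [j j_n aj] := entry_is_desc a i.
  rewrite aj in uri *; have [jk|kj] := leqP j k; first by apply: desc_noninc; lia.
  have : desc a j <= desc a k.+1 by apply: desc_noninc; lia.
  lra.
- by rewrite FbE; apply/andP; split; lra.
Qed.
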